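(* Let $G=(V,E)$ be a finite connected graph and let $\beta\in\mathcal{P}(E)$. Then $G$ is $\beta$-dense if and only if $G$ is $\beta$-homogeneous.
   Context: $G=(V,E)$ is a finite connected undirected graph; multi-edges are allowed, self-loops are not. $\Gamma$ is the set of all spanning trees of $G$ (viewed as edge sets). $\mathcal{P}(X)$ is the set of probability mass functions on a finite set $X$. For $\mu\in\mathcal{P}(\Gamma)$, the edge usage probability vector is $\eta_\mu(e)=\sum_{\gamma\in\Gamma,\,\gamma\ni e}\mu(\gamma)$. $G$ is $\beta$-homogeneous if there exists $\mu\in\mathcal{P}(\Gamma)$ with $\eta_\mu(e)/(|V|-1)=\beta(e)$ for all $e\in E$. $\mathcal{S}(G)$ is the family of all connected subgraphs $H=(V_H,E_H)$ of $G$ with $|E_H|\ge 1$ that are edge-induced, i.e. obtained by removing all edges of $E\setminus E_H$ from $G$ and deleting any vertices of degree zero. For $H\in\mathcal{S}(G)$, the $\beta$-density is $\theta_\beta(H)=\beta(E_H)/(|V_H|-1)$, where $\beta(E_H)=\sum_{e\in E_H}\beta(e)$. $G$ is $\beta$-dense if $\theta_\beta(H)\le\theta_\beta(G)$ for all $H\in\mathcal{S}(G)$. *)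

(* Defs.v *)
From mathcomp Require Import all_boot all_order all_algebra.
From mathcomp Require Import boolp reals.

Set Implicit Arguments.
Unset Strict Implicit.
Unset Printing Implicit Defensive.

Import Order.TTheory GRing.Theory Num.Theory.
Local Open Scope ring_scope.

(* [ends] need not be injective (multi-edges); an edge has two distinct ends
   (no self-loops). *)
Record multigraph (V E : finType) := Multigraph {
  ends : E -> {set V};
  ends_card : forall e, #|ends e| = 2%N }.

Record subgraph (V E : finType) (G : multigraph V E) := Subgraph {
  svert : {set V};
  sedge : {set E};
  sends : forall e, e \in sedge -> ends G e \subset svert }.

Section Graphs.
Variables (V E : finType) (G : multigraph V E).
Implicit Types (H : subgraph G) (F : {set E}).

Definition spanning_subgraph F : subgraph G :=
  @Subgraph V E G [set: V] F (fun e _ => subsetT (ends G e)).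

Definition whole : subgraph G := spanning_subgraph [set: E].

Definition adj H : rel V :=
  fun u v => [exists e in sedge H, ends G e == [set u; v]].

(* The empty graph is not connected. *)
Definition connected H : Prop :=
  svert H != set0 /\ {in svert H &, forall u v, connect (adj H) u v}.

(* A cycle v_1, e_1, v_2, e_2, ..., v_k, e_k (back to v_1) is given as the
   list of the pairs (v_i, e_i), with distinct vertices and distinct edges, so
   that two parallel edges form a cycle of length 2. *)
Definition is_cycle H (c : seq (V * E)) : bool :=
  [&& c != [::], uniq (unzip1 c), uniq (unzip2 c)
    & cycle (fun p q => (p.2 \in sedge H) && (ends G p.2 == [set p.1; q.1])) c].

Definition acyclic H : Prop := forall c, ~~ is_cycle H c.

Definition is_tree H : Prop := connected H /\ acyclic H.

Definition spanning_tree : finType :=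
  {F : {set E} | `[< is_tree (spanning_subgraph F) >]}.

Definition degree H (v : V) : nat := #|[set e in sedge H | v \in ends G e]|.

Definition edge_induced H : Prop :=
  svert H = [set v | (0 < degree H v)%N].

Definition connected_edge_induced H : Prop :=
  [/\ connected H, edge_induced H & (1 <= #|sedge H|)%N].

End Graphs.

Record pmf (R : realType) (X : finType) := Pmf {
  pmf_fun :> X -> R;
  pmf_ge0 : forall x, 0 <= pmf_fun x;
  pmf_sum1 : \sum_x pmf_fun x = 1 }.

Section Density.
Variables (R : realType) (V E : finType) (G : multigraph V E).

Definition edge_usage (mu : pmf R (spanning_tree G)) (e : E) : R :=
  \sum_(gamma : spanning_tree G | e \in val gamma) mu gamma.

Definition homogeneous (beta : E -> R) : Prop :=
  exists mu : pmf R (spanning_tree G),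
    forall e, edge_usage mu e / (#|V|%:R - 1) = beta e.

Definition density (beta : E -> R) (H : subgraph G) : R :=
  (\sum_(e in sedge H) beta e) / (#|svert H|%:R - 1).

Definition dense (beta : E -> R) : Prop :=
  forall H : subgraph G, connected_edge_induced H -> density beta H <= density beta (whole G).

End Density.

(* Main.v *)
Require Import Defs.
From mathcomp Require Import all_boot all_order all_algebra.
From mathcomp Require Import boolp reals.
From mathcomp Require classical_sets topology normedtype derive.
From mathcomp Require Import ring lra.

(** Write [n = |V|] and [x e = (n - 1) * beta e], so that homogeneity says that
    [x] is the edge usage vector of a random spanning tree.

    Homogeneous implies dense: a spanning tree is a forest, so it has at most
    [|V_H| - 1] edges inside a subgraph [H] ([forest_card]); averaging over the
    random tree gives [x(E_H) <= |V_H| - 1], while the density of the whole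
    graph is [1 / (n - 1)].

    Dense implies homogeneous: this is the description of the spanning tree
    polytope by its rank inequalities. Among the usage vectors of
    distributions on spanning trees, a compact set, let [eta], the usage vector
    of [mu], be the nearest to [x] ([nearest_exists]). Moving mass from a tree
    [T] in the support of [mu] to another tree cannot decrease the distance
    ([nearest_variational]). Let [A] be the set of edges [e] with
    [eta e < x e]. If the ends of some [e] in [A] were not joined by the edges
    of [T] in [A], then [e] could replace in [T] some edge [b] outside [A]
    ([tree_exchange]); that move brings [eta] closer to [x], as [eta e < x e]
    and [eta b >= x b]. Hence the edges of [T] in [A] span [A], and applying
    density to each component of [A] gives [x(A) <= |T :&: A|]
    ([dense_spanned]). Averaging over [mu] gives [x(A) <= eta(A)], so [A] is
    empty, [x <= eta], and [x = eta] since both vectors sum to [n - 1]. *)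

Set Implicit Arguments.
Unset Strict Implicit.
Unset Printing Implicit Defensive.

Import Order.TTheory GRing.Theory Num.Theory.

(** * Edge sets, forests and spanning trees *)

Section Linked.
Variables (V E : finType) (G : multigraph V E).
Implicit Types (F T A : {set E}) (C S : {set V}) (e b : E).

Lemma adjP (H : subgraph G) x y :
  reflect (exists2 e, e \in sedge H & ends G e = [set x; y]) (adj H x y).
Proof.
by apply: (iffP exists_inP) => -[e eH /eqP h]; exists e => //; apply/eqP.
Qed.

Lemma endsP e : exists x y, x != y /\ ends G e = [set x; y].
Proof.
have /eqP/cards2P[x [y [xy ->]]] := ends_card G e.
by exists x, y.
Qed.

(** [linked F x y]: the edges of [F] contain a path from [x] to [y]. *)
Definition linked F : rel V := connect (adj (spanning_subgraph G F)).

Lemma linked_refl F x : linked F x x. Proof. exact: connect0. Qed.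

Lemma linked_sym F : symmetric (linked F).
Proof.
apply: sym_connect_sym => u v.
by apply/adjP/adjP => -[e eF h]; exists e; rewrite // setUC.
Qed.

Lemma linked_trans F : transitive (linked F).
Proof. by move=> y x z; apply: connect_trans. Qed.

Lemma linked_ends F e x y :
  e \in F -> x \in ends G e -> y \in ends G e -> linked F x y.
Proof.
move=> eF; have [u [v [_ h]]] := endsP e; rewrite h.
have uv : linked F u v by apply/connect1/adjP; exists e.
have vu : linked F v u by rewrite linked_sym.
by rewrite !inE => /orP[]/eqP-> /orP[]/eqP-> //; apply: linked_refl.
Qed.

(** A set of vertices that is closed along the edges of [F] contains, with a
    vertex, everything linked to it. *)
Lemma linked_ind F (P : pred V) x y :
    (forall e u v, e \in F -> u \in ends G e -> v \in ends G e -> P u -> P v) ->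
  linked F x y -> P x -> P y.
Proof.
move=> cl /connectP[p + ->] {y}; elim: p x => [|z p IH] x //=.
case/andP=> /adjP[e /= eF h] /IH{}IH Px; apply: IH; apply: (cl e x) Px => //.
  by rewrite h !inE eqxx.
by rewrite h !inE eqxx orbT.
Qed.

Lemma linked_sub F F' x y :
    (forall e u v, e \in F -> u \in ends G e -> v \in ends G e ->
      linked F' u v) ->
  linked F x y -> linked F' x y.
Proof.
move=> cl xy; apply: (linked_ind (P := linked F' x)) xy (linked_refl _ _).
by move=> e u v eF ue ve /linked_trans; apply; apply: cl eF ue ve.
Qed.

Lemma linkedS F F' x y : F \subset F' -> linked F x y -> linked F' x y.
Proof.
by move=> /subsetP sF; apply: linked_sub => e u v /sF; apply: linked_ends.
Qed.

(** Vertices joined together by [F] number at most [|F| + 1]: a largest set [U]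
    around a root that spans at least [|U| - 1] edges of [F] is closed along
    [F]. *)
Lemma linked_card F S : S != set0 -> {in S &, forall x y, linked F x y} ->
  #|S| <= #|F|.+1.
Proof.
case/set0Pn=> r rS lS.
pose ok (U : {set V}) := (r \in U) && (#|U| <= #|[set e in F | ends G e \subset U]|.+1).
have ok1 : ok [set r] by rewrite /ok set11 cards1.
case: (@arg_maxnP _ [set r] ok (fun U : {set V} => #|U|) ok1) => U /andP[rU leU] maxU.
have sSU : S \subset U.
  apply/subsetP => x xS; apply: (linked_ind (P := mem U)) (lS _ _ rS xS) (rU).
  move=> e u v eF ue ve /= uU.
  apply: contraT => vU.
  have ee : ends G e = [set u; v].
    apply/esym/eqP; rewrite eqEcard ends_card subUset !sub1set ue ve /=.
    by rewrite cards2; case: eqP uU vU => // -> ->.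
  have : ok (v |: U).
    rewrite /ok !inE rU orbT cardsU1 vU add1n ltnS (leq_trans leU) //.
    apply: proper_card; apply/properP; split.
      apply/subsetP => f; rewrite !inE => /andP[-> h]; apply: subset_trans h _.
      exact: subsetUr.
    exists e; rewrite !inE eF /= ee subUset !sub1set ?(negPf vU) ?andbF //.
    by rewrite !inE uU eqxx orbT.
  by move/maxU; rewrite /= cardsU1 vU add1n ltnn.
apply: leq_trans (subset_leq_card sSU) (leq_trans leU _).
by rewrite ltnS subset_leq_card //; apply/subsetP => e; rewrite inE => /andP[].
Qed.

(** A forest, as an edge set all of whose edges are bridges. This form makes
    counting by deletion of an edge immediate; [acyclic_forest] relates it to
    the absence of cycles. *)
Definition forest F : Prop :=
  forall e x y, e \in F -> ends G e = [set x; y] -> ~~ linked (F :\ e) x y.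

Lemma forestS F F' : F \subset F' -> forest F' -> forest F.
Proof.
move=> sF fF e x y eF h; apply: contra (fF e x y (subsetP sF _ eF) h).
by apply: linkedS; apply: setSD.
Qed.

(** Removing an edge [xy] of [F] separates [S] into the vertices still linked
    to [x] and the others; the bound holds by induction on both sides. *)
Lemma forest_card F S : forest F -> (forall e, e \in F -> ends G e \subset S) ->
  S != set0 -> #|F| < #|S|.
Proof.
have [n] := ubnP #|F|; elim: n F S => // n IH F S leF fF FS S0.
have [->|[e eF]] := set_0Vmem F; first by rewrite cards0 card_gt0.
have [x [y [_ h]]] := endsP e.
have nxy := fF e x y eF h.
have ltn' F' : F' \subset F :\ e -> #|F'| < n.
  move=> /subset_leq_card sF; apply: leq_ltn_trans sF _.
  by move: leF; rewrite (cardsD1 e F) eF add1n ltnS.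
have fo' F' : F' \subset F :\ e -> forest F'.
  by move=> sF; apply: forestS fF; apply: subset_trans sF (subD1set _ _).
have [xS yS] : x \in S /\ y \in S.
  by have := FS e eF; rewrite h subUset !sub1set => /andP[].
pose C := [set z | linked (F :\ e) x z].
pose F1 := [set f in F :\ e | ends G f \subset C].
have s1 : F1 \subset F :\ e by apply/subsetP=> f; rewrite inE => /andP[].
have s2 : (F :\ e) :\: F1 \subset F :\ e by apply: subsetDl.
have c1 : #|F1| < #|S :&: C|.
  apply: IH (ltn' _ s1) (fo' _ s1) _ _.
    move=> f; rewrite !inE subsetI => /andP[/andP[_ /FS->] //].
  by apply/set0Pn; exists x; rewrite !inE xS linked_refl.
have c2 : #|(F :\ e) :\: F1| < #|S :\: C|.
  apply: IH (ltn' _ s2) (fo' _ s2) _ _; last first.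
    by apply/set0Pn; exists y; rewrite !inE yS andbT.
  move=> f /setDP[fFe nf1]; rewrite subsetD FS /=; last by case/setD1P: fFe.
  move: nf1; rewrite inE fFe /=; apply: contraR; rewrite -setI_eq0.
  case/set0Pn => z /setIP[zf]; rewrite inE => xz; apply/subsetP => w wf.
  by rewrite inE (linked_trans xz) //; apply: linked_ends fFe zf wf.
rewrite (cardsD1 e F) eF -(cardsID C S) -(cardsID F1 (F :\ e)) (setIidPr s1).
by rewrite add1n -addnS -addSn leq_add.
Qed.

(** A path with distinct vertices has distinct edges; the list [c] pairs each
    vertex but the last with the edge that leaves it, and the last vertex may
    be paired with any edge [e], in particular with one that closes a cycle. *)
Lemma path_edges F x p : path (adj (spanning_subgraph G F)) x p ->
    uniq (x :: p) ->
  exists c : seq (V * E), [/\ unzip1 c = belast x p, uniq (unzip2 c),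
    forall e, e \in unzip2 c -> e \in F /\ ends G e \subset x :: p &
    forall e, sorted (fun u v => (u.2 \in F) && (ends G u.2 == [set u.1; v.1]))
      (rcons c (last x p, e))].
Proof.
elim: p x => [|y p IH] x /=; first by exists [::].
case/andP=> /adjP[e /= eF h] pyp /andP[xnp uyp].
have [c [c1 c2 c3 c4]] := IH y pyp uyp; exists ((x, e) :: c); split => /=.
- by rewrite c1.
- rewrite c2 andbT; apply: contra xnp => /c3[_ /subsetP]; apply.
  by rewrite h !inE eqxx.
- move=> f; rewrite inE => /orP[/eqP->|/c3[fF /subsetP sf]].
    split=> //; apply/subsetP => z; rewrite h !inE.
    by case/orP=> /eqP->; rewrite eqxx ?orbT.
  by split=> //; apply/subsetP => z /sf zp; rewrite inE zp orbT.
- move=> f; have := c4 f; case: c c1 {c2 c3 c4} => [|[a b] c] /=.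
    case: p {IH pyp xnp uyp} => //= _ _; by rewrite eF h eqxx.
  case: p {IH pyp xnp uyp} => //= z p [-> _] ->.
  by rewrite eF h eqxx.
Qed.

Lemma acyclic_forest F : acyclic (spanning_subgraph G F) -> forest F.
Proof.
move=> ac e x y eF h; apply/negP => /connectP[p0 pp0 ylp0].
case/shortenP: pp0 ylp0 => p pp up _ ylp {p0}.
have [c [c1 c2 c3 c4]] := path_edges pp up.
have := ac (rcons c (y, e)); rewrite /is_cycle => /negP; apply; apply/and4P; split.
- by case: c {c1 c2 c3 c4}.
- by rewrite /unzip1 map_rcons [map _ c]c1 /= ylp -lastI.
- rewrite /unzip2 map_rcons rcons_uniq c2 andbT; apply/negP => /c3[].
  by rewrite !inE eqxx.
- rewrite ylp /=; have := c4 e.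
  have sub : subrel (fun u v : V * E => (u.2 \in F :\ e) && (ends G u.2 == [set u.1; v.1]))
     (fun u v => (u.2 \in F) && (ends G u.2 == [set u.1; v.1])).
    by move=> u v /andP[/setD1P[_ ->] ->].
  case: c c1 {c2 c3 c4} => [|[a b] c] /= c1.
    by case: p c1 ylp {pp up} => //= _ ylp; rewrite eF h ylp eqxx.
  move/(sub_path sub) => pc; rewrite rcons_path pc last_rcons /=.
  rewrite eF h -ylp; case: p c1 ylp {pc pp up} => //= z p [-> _] _.
  by rewrite setUC eqxx.
Qed.

(** Removing an edge of a cycle disconnects nothing. *)
Lemma cycle_removable F : ~ acyclic (spanning_subgraph G F) ->
  exists2 e, e \in F & forall x y, linked F x y -> linked (F :\ e) x y.
Proof.
move/existsNP => [c /negP]; rewrite negbK; case: c => [//|[a e] c].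
rewrite /is_cycle => /and4P[_ u1 u2 /= pc].
(* A portion of the cycle that avoids [e] links its two extremities. *)
have pathl (s : seq (V * E)) p : e \notin unzip2 (belast p s) ->
   path (fun p q => (p.2 \in F) && (ends G p.2 == [set p.1; q.1])) p s ->
   linked (F :\ e) p.1 (last p s).1.
  elim: s p => [|q s IH] p; first by rewrite linked_refl.
  rewrite /= inE negb_or => /andP[ep es] /andP[/andP[pF /eqP hp] ps].
  apply: linked_trans (IH q es ps); apply: (@linked_ends _ p.2).
  - by rewrite !inE pF eq_sym ep.
  - by rewrite hp !inE eqxx.
  - by rewrite hp !inE eqxx orbT.
case: c u1 u2 pc => [|[b f] c] /= _.
  by rewrite andbT => _ /andP[_ /eqP h]; have := ends_card G e; rewrite h setUid cards1.
case/andP=> ne _ /andP[/andP[eF /eqP h] pc]; exists e => //.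
have l : linked (F :\ e) b a.
  have := pathl (rcons c (a, e)) (b, f); rewrite last_rcons /=; apply => //.
  by rewrite belast_rcons.
move=> x y; apply: linked_sub => g u v gF ug vg.
have [ge|ge] := eqVneq g e; last by apply: linked_ends ug vg; rewrite !inE ge.
move: ug vg; rewrite ge h !inE => /orP[]/eqP-> /orP[]/eqP->; rewrite ?linked_refl //.
by rewrite linked_sym.
Qed.

Lemma tree_connected F : is_tree (spanning_subgraph G F) -> forall x y, linked F x y.
Proof. by case=> -[_ h] _ x y; apply: h; rewrite inE. Qed.

Lemma tree_card F : is_tree (spanning_subgraph G F) -> #|V| = #|F|.+1.
Proof.
move=> tF; have V0 : [set: V] != set0 by case: tF => -[].
apply/eqP; rewrite eqn_leq -cardsT linked_card //=; last first.
  by move=> x y ? ?; apply: tree_connected.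
apply: forest_card => //.
by apply: acyclic_forest; case: tF.
Qed.

(** A connected edge set with [|V| - 1] edges is a tree: otherwise an edge of a
    cycle could be removed, leaving too few edges to connect [V]. *)
Lemma tree_of_card F : (forall x y, linked F x y) -> #|V| = #|F|.+1 ->
  is_tree (spanning_subgraph G F).
Proof.
move=> lF cF; have V0 : [set: V] != set0 by rewrite -card_gt0 cardsT cF.
split; first by split => // x y _ _; apply: lF.
apply: contrapT => /cycle_removable[e eF lFe].
have : #|[set: V]| <= #|F :\ e|.+1.
  by apply: linked_card => // x y _ _; apply/lFe/lF.
by rewrite cardsT cF (cardsD1 e) eF add1n ltnn.
Qed.

(** A connected edge set of least cardinality is a tree. *)
Lemma tree_exists : connected (whole G) ->
  exists F, is_tree (spanning_subgraph G F).
Proof.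
move=> [V0 lV].
pose ok (F : {set E}) := [forall x, forall y, linked F x y].
have okT : ok [set: E].
  by apply/forallP => x; apply/forallP => y; apply: lV; rewrite inE.
case: (@arg_minnP _ [set: E] ok (fun F : {set E} => #|F|) okT) => F /forallP okF minF.
have lF x y : linked F x y by apply/forallP: y; apply: okF.
exists F; split; first by split => // x y _ _; apply: lF.
apply: contrapT => /cycle_removable[e eF lFe].
have /minF : ok (F :\ e).
  by apply/forallP => x; apply/forallP => y; apply: lFe.
by rewrite (cardsD1 e F) eF add1n ltnn.
Qed.

(** If the edges of [T] in [A] do not join the ends of an edge [e] of [A], then
    [e] can replace in [T] some edge outside [A]. *)
Lemma tree_exchange T A e x y : is_tree (spanning_subgraph G T) ->
    e \in A -> ends G e = [set x; y] -> ~~ linked (T :&: A) x y ->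
  exists2 b, b \in T :\: A &
    e \notin T /\ is_tree (spanning_subgraph G (e |: (T :\ b))).
Proof.
move=> tT eA h nxy; have lT := tree_connected tT.
have eT : e \notin T.
  apply: contra nxy => eT; apply: (@linked_ends _ e); rewrite ?h ?inE ?eqxx ?orbT //.
  by rewrite eT.
(* [B] is a smallest set between [T :&: A] and [T] that links [x] to [y]: it
   has an edge [b] outside [A], which separates [x] from [y] in [B]. *)
pose ok (B : {set E}) := [&& T :&: A \subset B, B \subset T & linked B x y].
have okT : ok T by rewrite /ok subsetIl subxx lT.
case: (@arg_minnP _ T ok (fun F : {set E} => #|F|) okT) => B /and3P[sAB sBT lB] minB.
have [b bB bA] : exists2 b, b \in B & b \notin A.
  apply/subsetPn; apply: contra nxy => BA; apply: linkedS lB.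
  by rewrite subsetI sBT.
have nB : ~~ linked (B :\ b) x y.
  apply/negP => lb; have /minB : ok (B :\ b).
    rewrite /ok lb andbT (subset_trans (subD1set _ _) sBT) subsetD1 sAB /=.
    by rewrite inE (negPf bA) andbF.
  by rewrite (cardsD1 b B) bB add1n ltnn.
have cross u v : linked B u v -> ~~ linked (B :\ b) u v ->
    exists2 p, p \in ends G b & linked (B :\ b) u p.
  move=> luv nuv; apply/exists_inP; apply: contraR nuv => /exists_inPn nb.
  apply: (linked_ind (P := linked (B :\ b) u)) luv (linked_refl _ _).
  move=> g s t gB sg tg us; have gb : g != b.
    by apply: contraL us => /eqP gb; apply: nb; rewrite -gb.
  by apply: linked_trans us _; apply: linked_ends sg tg; rewrite !inE gb.
(* The ends of [b] lie on both sides, so that in the exchanged tree they are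
   still joined, through [x], [e] and [y]. *)
have [p pb xp] := cross _ _ lB nB.
have [q qb yq] : exists2 q, q \in ends G b & linked (B :\ b) y q.
  by apply: (cross y x); rewrite linked_sym.
have pq : p != q.
  apply: contraNneq nB => pq; apply: linked_trans xp _; by rewrite pq linked_sym.
have eb : ends G b = [set p; q].
  by apply/esym/eqP; rewrite eqEcard ends_card subUset !sub1set pb qb cards2 pq.
have bT := subsetP sBT _ bB.
exists b; first by rewrite inE bA.
split=> //; set T' := e |: (T :\ b).
have sBT' : B :\ b \subset T'.
  by apply: subset_trans (subsetUr _ _); apply: setSD.
have lpq : linked T' p q.
  apply: (@linked_trans _ x); first by rewrite linked_sym (linkedS sBT').
  apply: (@linked_trans _ y); last by rewrite (linkedS sBT').
  by apply: (@linked_ends _ e); rewrite ?h !inE eqxx ?orbT.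
apply: tree_of_card => [u v|].
  have := lT u v; apply: linked_sub => g s t gT sg tg.
  have [gb|gb] := eqVneq g b; last by apply: linked_ends sg tg; rewrite !inE gb gT orbT.
  move: sg tg; rewrite gb eb !inE => /orP[]/eqP-> /orP[]/eqP->; rewrite ?linked_refl //.
  by rewrite linked_sym.
rewrite (tree_card tT) (cardsD1 b T) bT cardsU1 !inE (negPf eT) andbF.
by [].
Qed.

End Linked.

Local Open Scope ring_scope.

(** * The nearest point of a finitely generated convex hull *)

Section Nearest.
Import classical_sets topology normedtype derive numFieldNormedType.Exports.
Variables (R : realType) (X E : finType) (a : X -> E -> R) (x : E -> R).

(** The barycentre of the points [a t] with the weights [m t]. *)
Definition mean (m : X -> R) (e : E) : R := \sum_t m t * a t e.

(** The squared Euclidean distance from that barycentre to [x]. *)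
Definition sqdist (m : X -> R) : R := \sum_e (mean m e - x e) ^+ 2.

(** The simplex is compact and the distance is continuous. The point [t0] only
    says that [X] is not empty. *)
Lemma nearest_exists (t0 : X) :
  exists mu : pmf R X, forall nu : pmf R X, sqdist mu <= sqdist nu.
Proof.
pose fn (v : 'rV[R]_#|X|) (t : X) := v 0 (enum_rank t).
have cfn t : continuous (fun v => fn v t) by apply: coord_continuous.
have cadd : continuous (fun p : R * R => p.1 + p.2) by apply: add_continuous.
have csum (I : finType) (F : I -> 'rV[R]_#|X| -> R) :
    (forall i, continuous (F i)) -> continuous (fun v => \sum_i F i v).
  by move=> cF; apply: (@continuous_big R I +%R 0 predT cadd).
(* The simplex, as the part of the unit cube on the hyperplane [hyp]. *)
pose cube := [set v : 'rV[R]_#|X| | forall i, `[0, 1]%classic (v ord0 i)]%classic.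
pose hyp := [set v | \sum_t fn v t = 1]%classic.
have ccube : compact cube.
  by apply: (@rV_compact _ _ (fun=> `[0 : R, 1]%classic)) => i; apply: segment_compact.
have chyp : closed hyp.
  apply: (@preimage_closed _ _ (fun v => \sum_t fn v t) [set 1]%classic).
    by move=> v _; apply: (csum).
  exact: closed_eq.
have cdist : continuous (fun v => sqdist (fn v)).
  apply: (csum) => e v.
  have cm : continuous (fun v => mean (fn v) e - x e).
    move=> w; apply: continuousB; last exact: cst_continuous.
    by apply: (csum) => t u; apply: continuousM; [apply: (cfn)|apply: cst_continuous].
  exact: (continuousM (cm v) (cm v)).
have pmf_vec (nu : pmf R X) :
    exists2 v, v \in (cube `&` hyp)%classic & sqdist (fn v) = sqdist nu.
  have e t : fn (\row_i nu (enum_val i)) t = nu t by rewrite /fn mxE enum_rankK.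
  exists (\row_i nu (enum_val i)).
    apply/mem_set; split => [i|]; rewrite /cube /hyp /=.
      rewrite mxE in_itv /= pmf_ge0 -(pmf_sum1 nu) (bigD1 (enum_val i)) //=.
      by rewrite lerDl sumr_ge0 // => t _; apply: pmf_ge0.
    by rewrite -(pmf_sum1 nu); apply: eq_bigr.
  apply: eq_bigr => f _; congr ((_ - _) ^+ 2).
  by apply: eq_bigr => t _; rewrite e.
have d0 t : 0 <= (t == t0)%:R :> R by apply: ler0n.
have d1 : \sum_t (t == t0)%:R = 1 :> R.
  by rewrite (bigD1 t0) //= eqxx big1 ?addr0 // => t /negPf->.
have ne : ((cube `&` hyp) !=set0)%classic.
  by have [v /set_mem vA _] := pmf_vec (Pmf d0 d1); exists v.
have [v /set_mem[cv hv] vmin] := EVT_min_rV ne (compact_closedI ccube chyp)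
  (continuous_subspaceT cdist).
have v0 t : 0 <= fn v t by have := cv (enum_rank t); rewrite /= in_itv /= => /andP[].
exists (Pmf v0 hv) => nu; have [w wA <-] := pmf_vec nu.
exact: vmin.
Qed.

(** First-order condition at a nearest point: no transfer of mass from a point
    [t] of the support to another point [t'] goes towards [x]. *)
Lemma nearest_variational (mu : pmf R X) (t t' : X) :
    (forall nu : pmf R X, sqdist mu <= sqdist nu) -> 0 < mu t ->
  0 <= \sum_e (mean mu e - x e) * (a t' e - a t e).
Proof.
move=> mumin mut; rewrite leNgt; apply/negP; set L := \sum_e _ => L0.
pose Q := \sum_e (a t' e - a t e) ^+ 2.
have Q0 : 0 <= Q by apply: sumr_ge0 => e _; apply: sqr_ge0.
(* Moving mass [d] changes the squared distance by [d * (2 * L + d * Q)], which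
   is negative for a [d] this small if [L < 0]. *)
pose d := Num.min (mu t) (- L / (Q + 1)).
have d_gt0 : 0 < d by rewrite lt_min mut divr_gt0 ?oppr_gt0 // ltr_wpDl.
have d_mut : d <= mu t by rewrite ge_min lexx.
have dQ : d * Q <= - L.
  apply: (@le_trans _ _ (d * (Q + 1))); first by rewrite ler_pM2l // lerDl ler01.
  by rewrite -ler_pdivlMr ?ltr_wpDl // ge_min lexx orbT.
pose nf s := mu s + d * ((s == t')%:R - (s == t)%:R).
have delta (s0 : X) (g : X -> R) : \sum_s (s == s0)%:R * g s = g s0.
  by rewrite (bigD1 s0) //= eqxx mul1r big1 ?addr0 // => s /negPf->; rewrite mul0r.
have nf0 s : 0 <= nf s.
  rewrite /nf; have := pmf_ge0 mu s.
  by case: eqP => _; case: eqP => [->|_] /=; lra.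
have nf1 : \sum_s nf s = 1.
  have one (s0 : X) : \sum_s (s == s0)%:R = 1 :> R.
    by rewrite -[RHS](delta s0 (fun=> 1)); apply: eq_bigr => s _; rewrite mulr1.
  by rewrite big_split /= pmf_sum1 -mulr_sumr sumrB !one subrr mulr0 addr0.
have mean_nf e : mean nf e = mean mu e + d * (a t' e - a t e).
  rewrite /mean -(delta t' (a^~ e)) -(delta t (a^~ e)) -sumrB mulr_sumr -big_split.
  by apply: eq_bigr => s _; rewrite /nf /=; ring.
have := mumin (Pmf nf0 nf1); rewrite leNgt => /negP; apply.
have -> : sqdist (Pmf nf0 nf1) = sqdist mu + d * (2 * L + d * Q).
  rewrite /sqdist /L /Q !mulr_sumr -big_split /= mulr_sumr -big_split /=.
  by apply: eq_bigr => e _; rewrite mean_nf; ring.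
rewrite gtrDl pmulr_rlt0 //; lra.
Qed.

End Nearest.

(** * Density and edge usage *)

Section Density.
Variables (R : realType) (V E : finType) (G : multigraph V E).
Implicit Types (A F : {set E}) (mu : pmf R (spanning_tree G)).

Lemma svert_gt1 (H : subgraph G) e : e \in sedge H -> (1 < #|svert H|)%N.
Proof. by move=> eH; rewrite -(ends_card G e) subset_leq_card ?sends. Qed.

(** A probability on [E] needs an edge, hence two vertices. *)
Lemma pmf_vertices_gt1 (beta : pmf R E) : (1 < #|V|)%N.
Proof.
have [e _] : exists e : E, e \in E.
  apply/existsP; apply: contraT => /existsPn E0; have := pmf_sum1 beta.
  by rewrite big1 => [/eqP|e]; [rewrite eq_sym oner_eq0|have := E0 e].
by have := @svert_gt1 (whole G) e (in_setT e); rewrite cardsT.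
Qed.

Lemma density_whole (beta : pmf R E) :
  density beta (whole G) = (#|V|%:R - 1)^-1.
Proof.
rewrite /density cardsT -[RHS]mul1r; congr (_ / _).
by rewrite -(pmf_sum1 beta); apply: eq_bigl => e; rewrite inE.
Qed.

Lemma usageE mu e :
  edge_usage mu e = \sum_gamma mu gamma * (e \in val gamma)%:R.
Proof.
by rewrite /edge_usage big_mkcond; apply: eq_bigr => g _; case: ifP; rewrite ?mulr1 ?mulr0.
Qed.

(** The usage of [A] is the mean number of edges of the tree in [A]. *)
Lemma usage_sum mu A :
  \sum_(e in A) edge_usage mu e = \sum_gamma mu gamma * #|val gamma :&: A|%:R.
Proof.
under eq_bigr do rewrite usageE.
rewrite exchange_big; apply: eq_bigr => g _ /=; rewrite -mulr_sumr; congr (_ * _).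
rewrite -sum1_card natr_sum big_mkcond [RHS]big_mkcond /=; apply: eq_bigr => e _.
by rewrite inE; case: (e \in A); case: (e \in val g).
Qed.

Lemma spanning_treeP (gamma : spanning_tree G) : is_tree (spanning_subgraph G (val gamma)).
Proof. exact/asboolP/(valP gamma). Qed.

Definition tree_of F (tF : is_tree (spanning_subgraph G F)) : spanning_tree G :=
  exist _ F (asboolT tF).

Lemma homogeneous_dense (beta : pmf R E) : homogeneous G beta -> dense G beta.
Proof.
move=> [mu hmu] H [[S0 _] _ /card_gt0P[e0 e0H]].
have k0 : 0 < #|svert H|%:R - 1 :> R by rewrite subr_gt0 ltr1n (svert_gt1 e0H).
have m0 : 0 < #|V|%:R - 1 :> R by rewrite subr_gt0 ltr1n (pmf_vertices_gt1 beta).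
rewrite density_whole /density ler_pdivrMr // mulrC.
rewrite -(eq_bigr _ (fun e _ => hmu e)) -mulr_suml ler_pM2r ?invr_gt0 // usage_sum.
rewrite -[leRHS]mul1r -[X in _ <= X * _](pmf_sum1 mu) mulr_suml ler_sum // => g _.
apply: ler_wpM2l; first exact: pmf_ge0.
rewrite lerBrDr natr1 ler_nat; apply: forest_card S0 => [|e].
  apply: forestS (subsetIl _ _) _; apply: acyclic_forest.
  exact: (spanning_treeP g).2.
by rewrite inE => /andP[_]; apply: sends.
Qed.

(** In a dense graph, [x(A)] is at most the cardinal of any subset [F] of [A]
    that joins the ends of every edge of [A]: density bounds the part of [x(A)]
    in each component [C] by [|C| - 1], and [F] has at least as many edges
    in [C]. *)
Lemma dense_spanned (beta : pmf R E) A F : dense G beta -> F \subset A ->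
    (forall e u v, e \in A -> u \in ends G e -> v \in ends G e ->
      linked G F u v) ->
  \sum_(e in A) (#|V|%:R - 1) * beta e <= #|F|%:R.
Proof.
move=> dG /subsetP FA spF.
have m0 : 0 < #|V|%:R - 1 :> R by rewrite subr_gt0 ltr1n (pmf_vertices_gt1 beta).
pose comp u := [set w | linked G F u w].
have compE u w : linked G F u w -> comp w = comp u.
  move=> uw; apply/setP => z; rewrite !inE; apply/idP/idP; apply: linked_trans => //.
  by rewrite linked_sym.
(* The component of [F] that contains the ends of [e]. *)
pose key e := [set w | [exists u in ends G e, linked G F u w]].
have keyE e u : e \in A -> u \in ends G e -> key e = comp u.
  move=> eA ue; apply/setP => w; rewrite !inE; apply/exists_inP/idP.
    by case=> v ve; apply: linked_trans; apply: spF eA ue ve.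
  by exists u.
rewrite -sum1_card natr_sum (partition_big key predT) //=.
rewrite [leRHS](partition_big key predT) //=; apply: ler_sum => C _.
pose AC := [set e in A | key e == C]; pose FC := [set e in F | key e == C].
rewrite (eq_bigl (mem AC)) => [|e]; last by rewrite /= inE.
rewrite -natr_sum [X in _ <= X%:R](eq_bigl (mem FC)) => [|e]; last by rewrite /= inE.
rewrite sum1_card.
have [->|[e0 e0AC]] := set_0Vmem AC; first by rewrite big_set0 ler0n.
have [u0 [u1 [_ h0]]] := endsP G e0.
have u0e : u0 \in ends G e0 by rewrite h0 !inE eqxx.
have /andP[e0A /eqP e0C] : (e0 \in A) && (key e0 == C) by move: e0AC; rewrite inE.
have CE : C = comp u0 by rewrite -e0C (keyE _ _ e0A u0e).
have keyC g s : g \in A -> s \in ends G g -> s \in C -> key g = C.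
  by move=> gA sg; rewrite CE inE => us; rewrite (keyE _ _ gA sg) (compE _ _ us).
have endsC g : g \in AC -> ends G g \subset C.
  rewrite inE => /andP[gA /eqP <-]; apply/subsetP => w wg.
  by rewrite (keyE _ _ gA wg) inE linked_refl.
have FCAC : FC \subset AC.
  by apply/subsetP => g; rewrite !inE => /andP[/FA -> ->].
pose H := Subgraph endsC.
have lC : {in C &, forall v w, linked G FC v w}.
  move=> v w vC wC; have vw : linked G F v w.
    move: vC wC; rewrite CE !inE => u0v; apply: linked_trans; by rewrite linked_sym.
  suff /andP[] : (w \in C) && linked G FC v w by [].
  apply: (linked_ind (P := fun y => (y \in C) && linked G FC v y)) vw _; last first.
    by rewrite vC linked_refl.
  move=> g s t gF sg tg /andP[sC vs].
  have gC := keyC g s (FA _ gF) sg sC.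
  have gFC : g \in FC by rewrite inE gF gC eqxx.
  rewrite (subsetP (endsC g (subsetP FCAC _ gFC))) //=.
  by apply: linked_trans vs _; apply: linked_ends gFC sg tg.
have C0 : C != set0 by apply/set0Pn; exists u0; rewrite CE inE linked_refl.
have cH : connected H.
  by split=> // v w vC wC; apply: (linkedS FCAC); apply: lC.
have iH : edge_induced H.
  apply/setP => v; rewrite inE card_gt0; apply/idP/set0Pn => [|[e]]; last first.
    by rewrite inE => /andP[/endsC/subsetP]; apply.
  rewrite /= {1}CE inE => u0v.
  suff /exists_inP[e eAC ve] : [exists e in AC, v \in ends G e].
    by exists e; rewrite inE eAC.
  apply: (linked_ind (P := fun y => [exists e in AC, y \in ends G e])) u0v _.
    move=> g s t gF sg tg /exists_inP[e eAC se]; apply/exists_inP; exists g => //.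
    have sC := subsetP (endsC e eAC) s se.
    by rewrite inE (FA _ gF) (keyC g s) ?FA //=.
  by apply/exists_inP; exists e0.
have eH : (1 <= #|sedge H|)%N by apply/card_gt0P; exists e0.
have k0 : 0 < #|C|%:R - 1 :> R by rewrite subr_gt0 ltr1n (@svert_gt1 H _ e0AC).
have := dG H (And3 cH iH eH).
rewrite density_whole /density /= ler_pdivrMr // ler_pdivlMl // => le1.
rewrite -mulr_sumr; apply: le_trans le1 _.
by rewrite lerBlDr natr1 ler_nat; apply: linked_card C0 lC.
Qed.

Lemma dense_homogeneous (beta : pmf R E) :
  connected (whole G) -> dense G beta -> homogeneous G beta.
Proof.
move=> /tree_exists[T0 tT0] dG.
pose t0 := tree_of tT0.
have m0 : 0 < #|V|%:R - 1 :> R by rewrite subr_gt0 ltr1n (pmf_vertices_gt1 beta).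
pose x e := (#|V|%:R - 1) * beta e.
pose a (g : spanning_tree G) e : R := (e \in val g)%:R.
have [mu mumin] := nearest_exists a x t0.
pose A := [set e | edge_usage mu e < x e].
have spA (g : spanning_tree G) : 0 < mu g ->
    \sum_(e in A) x e <= #|val g :&: A|%:R.
  move=> mug; apply: dense_spanned => //; first exact: subsetIr.
  move=> e u v eA ue ve; have [->|uv] := eqVneq u v; first exact: linked_refl.
  have h : ends G e = [set u; v].
    by apply/esym/eqP; rewrite eqEcard ends_card subUset !sub1set ue ve cards2 uv.
  apply: contraT => nuv.
  have [b /setDP[bT bA] [eT tT']] := tree_exchange (spanning_treeP g) eA h nuv.
  pose g' := tree_of tT'.
  (* The vectors of [g'] and [g] differ only at [e] and [b], so the first-order
     condition reads [eta b - x b <= eta e - x e]. *)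
  have := nearest_variational g' mumin mug.
  have be : b != e by apply: contraNneq eT => <-.
  rewrite (bigD1 e) //= (bigD1 b) //= big1 => [|f /andP[fe fb]]; last first.
    by rewrite /a /= !inE (negPf fe) fb /= subrr mulr0.
  rewrite /a /= !inE !eqxx (negPf eT) bT (negPf be) /= subr0 mulr1 sub0r mulrN1 addr0.
  move: eA bA; rewrite !inE !usageE /mean; lra.
have A0 : A = set0.
  apply/eqP; apply: contraT => /set0Pn[e eA].
  have : \sum_(e in A) x e <= \sum_(e in A) edge_usage mu e.
    have -> : \sum_(e in A) x e = \sum_g mu g * \sum_(e in A) x e.
      by rewrite -mulr_suml pmf_sum1 mul1r.
    rewrite usage_sum ler_sum // => g _.
    have [-> |mug] := eqVneq (mu g) 0; first by rewrite !mul0r.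
    apply: ler_wpM2l; first exact: pmf_ge0.
    by apply: spA; rewrite lt_neqAle eq_sym mug pmf_ge0.
  rewrite leNgt => /negP[]; apply: ltr_sum => [|f]; last by rewrite inE.
  by apply/hasP; exists e => //; apply: mem_index_enum.
have le_x e : x e <= edge_usage mu e.
  by rewrite leNgt; apply/negP => ex; have := in_set0 e; rewrite -A0 inE ex.
have s0 : \sum_e (edge_usage mu e - x e) = 0.
  rewrite sumrB -mulr_sumr pmf_sum1 mulr1.
  rewrite (eq_bigl (mem [set: E])) => [|e]; last by rewrite /= inE.
  rewrite usage_sum; under eq_bigr => g _ do
    rewrite setIT -[#|_|%:R](addrK 1) natr1 -(tree_card (spanning_treeP g)).
  by rewrite -mulr_suml pmf_sum1 mul1r subrr.
exists mu => e.
have /eqP := s0; rewrite psumr_eq0 => [/allP/(_ e (mem_index_enum e))/=|f _]; last first.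
  by rewrite subr_ge0.
rewrite subr_eq0 => /eqP->; rewrite /x mulrAC divff ?mul1r //; exact: lt0r_neq0.
Qed.

End Density.

Theorem lemma1p13 (R : realType) (V E : finType) (G : multigraph V E)
    (beta : pmf R E) (hG : connected (whole G)) :
  dense G beta <-> homogeneous G beta.
Proof. by split; [apply: dense_homogeneous | apply: homogeneous_dense]. Qed.
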